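(* Let $(X,\mathcal{A},\mu)$ be a measure space and let $I$ be an ideal of the ring $\mathcal{M}(X,\mathcal{A})$. Then $(L_I^\infty(\mu),\|\cdot\|_I^\infty)$ is a pseudonormed linear space over $\mathbb{R}$.
   Context: $X$ is a non-empty set, $\mathcal{A}$ a $\sigma$-algebra on $X$, and $\mu:\mathcal{A}\to[0,\infty]$ a measure. $\mathcal{M}(X,\mathcal{A})$ is the commutative ring with unity of all real-valued $\mathcal{A}$-measurable functions on $X$, with pointwise operations. For $g\in\mathcal{M}(X,\mathcal{A})$, $Z(g)=\{x\in X: g(x)=0\}$, and for an ideal $I$, $Z[I]=\{Z(g): g\in I\}$. Null sets $E$ below are always members of $\mathcal{A}$. A function $f\in\mathcal{M}(X,\mathcal{A})$ is essentially $I$-bounded on $X$ if there exist $Z\in Z[I]$, $E\subseteq Z$ with $\mu(E)=0$, and a real number $\lambda>0$ such that $|f(x)|\le\lambda$ for all $x\in Z\setminus E$; any such $\lambda$ is called an essential $I$-upper bound of $f$ over $X$. $L_I^\infty(\mu)$ is the set of all essentially $I$-bounded functions in $\mathcal{M}(X,\mathcal{A})$, with pointwise linear operations. For $f\in L_I^\infty(\mu)$, $\|f\|_I^\infty$ is the infimum of the set of all essential $I$-upper bounds of $f$ over $X$. A pseudonorm is a seminorm: a non-negative real-valued function that vanishes at $0$, is subadditive, and satisfies $\|cf\|=|c|\,\|f\|$ for $c\in\mathbb{R}$ (it may vanish at non-zero vectors). *)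

(* Defs.v *)
From HB Require Import structures.
From mathcomp Require Import all_boot all_order all_algebra.
From mathcomp Require Import all_classical all_reals all_analysis.
From mathcomp Require Import measurable_realfun.

Set Implicit Arguments.
Unset Strict Implicit.
Unset Printing Implicit Defensive.

Import Order.TTheory GRing.Theory Num.Theory.
Import numFieldNormedType.Exports.

Local Open Scope classical_set_scope.
Local Open Scope ring_scope.

(* [idealr_closed] of ring_quotient.v only describes proper ideals; here the
   whole ring is allowed. *)
Definition is_ideal (A : comNzRingType) (I : set A) : Prop :=
  [/\ I 0,
      forall a b, I a -> I b -> I (a + b) &
      forall a b, I b -> I (a * b)].

Record is_pseudonorm (R : numDomainType) (V : lmodType R) (S : set V)
    (N : V -> R) : Prop := IsPseudonorm {
  pseudonorm_ge0 : forall u, S u -> 0 <= N u ;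
  pseudonorm0 : N 0 = 0 ;
  ler_pseudonormD : forall u v, S u -> S v -> N (u + v) <= N u + N v ;
  pseudonormZ : forall c u, S u -> N (c *: u) = `|c| * N u
}.

(* S is a linear space for the operations inherited from V, that is, a linear
   subspace of V, and N restricted to S is a pseudonorm. *)
Definition pseudonormed_subspace (R : numDomainType) (V : lmodType R)
    (S : set V) (N : V -> R) : Prop :=
  submod_closed (mem S) /\ is_pseudonorm S N.

Definition zero_set (X : Type) (R : nmodType) (g : X -> R) : set X :=
  [set x | g x = 0].

Section ess_ideal_bounded.
Context d (X : measurableType d) (R : realType).
Variables (mu : {measure set X -> \bar R}) (I : set {mfun X >-> R}).

Definition zero_sets : set (set X) := [set zero_set g | g in I].

Definition ess_ideal_ubound (f : {mfun X >-> R}) : set R :=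
  [set l | 0 < l /\ exists Z E : set X,
     [/\ zero_sets Z, E `<=` Z, measurable E, mu E = 0%E &
         forall x, (Z `\` E) x -> `|f x| <= l]].

Definition ess_ideal_bounded : set {mfun X >-> R} :=
  [set f | exists l, ess_ideal_ubound f l].

Definition ess_ideal_norm (f : {mfun X >-> R}) : R :=
  inf (ess_ideal_ubound f).

End ess_ideal_bounded.

(* Main.v *)
Require Import Defs.
From mathcomp Require Import all_boot all_order all_algebra.
From mathcomp Require Import all_classical all_reals all_analysis.
From mathcomp Require Import measurable_realfun.

(** The zero sets of an ideal form a filter base: [X] is the zero set of [0],
    and the zero sets of [g] and [h] meet in the zero set of [g ^+ 2 + h ^+ 2],
    which the ideal contains with [g] and [h].  Essential boundedness along
    this filter base therefore behaves like ordinary essential boundedness.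
    A bound [l] of [f] and a bound [m] of [g] give the bound [l + m] of
    [f + g] (intersect the zero sets and unite the null sets:
    [ess_ideal_uboundD]), and [`|c| * l] bounds [c *: f] for non-zero [c]
    ([ess_ideal_uboundZ]).  Taking infima of bounds yields subadditivity and
    [N (c *: f) <= `|c| * N f]; the latter, applied also to [c^-1] and
    [c *: f], is homogeneity.  Since bounds are required to be positive,
    [c = 0] is treated apart: every positive number bounds the zero function,
    so its pseudonorm is [0]. *)

Import Order.TTheory GRing.Theory Num.Theory.

Local Open Scope classical_set_scope.
Local Open Scope ring_scope.

Section essential_bounds.
Context {d : measure_display} {X : measurableType d} {R : realType}.
Context (mu : {measure set X -> \bar R}) {I : set {mfun X >-> R}}.
Hypothesis hI : is_ideal I.
Implicit Types (f g : {mfun X >-> R}) (c l m : R).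

Local Notation ub := (ess_ideal_ubound mu I).
Local Notation bounded := (ess_ideal_bounded mu I).
Local Notation N := (ess_ideal_norm mu I).

Lemma zero_setsT : zero_sets I [set: X].
Proof.
case: hI => I0 _ _; exists 0 => //.
by apply/seteqP; split.
Qed.

(** In the reals a sum of two squares vanishes only where both terms do. *)
Lemma zero_setsI (Y Z : set X) :
  zero_sets I Y -> zero_sets I Z -> zero_sets I (Y `&` Z).
Proof.
case: hI => _ ID IM [g Ig <-] [h Ih <-].
exists (g * g + h * h); first by apply: ID; apply: IM.
have sqE x : (g * g + h * h) x = g x ^+ 2 + h x ^+ 2 by [].
apply/seteqP; split => x; rewrite /zero_set /mkset sqE.
  move=> /eqP; rewrite paddr_eq0 ?sqr_ge0//.
  by rewrite !sqrf_eq0 => /andP[/eqP gx /eqP hx].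
by case=> gx hx; rewrite gx hx expr0n addr0.
Qed.

Lemma ess_ideal_ubound0 l : 0 < l -> ub 0 l.
Proof.
move=> l0; split=> //; exists [set: X], set0; split=> //.
- exact: zero_setsT.
- by move=> x _; rewrite normr0 ltW.
Qed.

(** The exceptional null set of a bound must lie inside its zero set, so the
    union of the two null sets is cut down to the common zero set, which is
    measurable because the functions of [I] are. *)
Lemma ess_ideal_uboundD f g l m : ub f l -> ub g m -> ub (f + g) (l + m).
Proof.
move=> [l0 [Y [E [IY EY mE E0 fl]]]] [m0 [Z [F [IZ FZ mF F0 gm]]]].
have IYZ := zero_setsI _ _ IY IZ.
have mYZ : measurable (Y `&` Z).
  case: IYZ => k _ <-; rewrite -[zero_set k]setTI.
  exact: (measurable_funP k measurableT [set 0] (measurable_set1 0)).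
split; first exact: addr_gt0.
exists (Y `&` Z), ((Y `&` Z) `&` (E `|` F)); split => //.
- by apply: measurableI => //; apply: measurableU.
- apply: (@subset_measure0 _ _ _ mu _ (E `|` F)).
  + by apply: measurableI => //; apply: measurableU.
  + exact: measurableU.
  + exact: subIsetr.
  + by apply: etrans E0; apply: measureU0.
move=> x [[Yx Zx] nEF]; apply: le_trans (ler_normD _ _) _; apply: lerD.
  by apply: fl; split=> // Ex; apply: nEF; split=> //; left.
by apply: gm; split=> // Fx; apply: nEF; split=> //; right.
Qed.

Lemma ess_ideal_uboundZ c f l : c != 0 -> ub f l -> ub (c *: f) (`|c| * l).
Proof.
move=> c0 [l0 [Z [E [IZ EZ mE E0 fl]]]]; split.
  by rewrite mulr_gt0// normr_gt0.
exists Z, E; split => // x /fl fxl.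
rewrite (_ : (c *: f) x = c * f x) // normrM.
exact: ler_wpM2l.
Qed.

Lemma ess_ideal_norm_le f l : ub f l -> N f <= l.
Proof. by apply: ge_inf; exists 0 => k [/ltW]. Qed.

Lemma ess_ideal_norm_ge f l : bounded f -> (forall k, ub f k -> l <= k) ->
  l <= N f.
Proof. by move=> Bf lf; apply: lb_le_inf. Qed.

Lemma ess_ideal_norm_ge0 f : bounded f -> 0 <= N f.
Proof. by move=> Bf; apply: ess_ideal_norm_ge => // k [/ltW]. Qed.

Lemma ess_ideal_bounded0 : bounded 0.
Proof. by exists 1; apply: ess_ideal_ubound0. Qed.

Lemma ess_ideal_boundedD f g : bounded f -> bounded g -> bounded (f + g).
Proof.
by move=> [l fl] [m gm]; exists (l + m); apply: ess_ideal_uboundD.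
Qed.

Lemma ess_ideal_boundedZ c f : bounded f -> bounded (c *: f).
Proof.
have [->|c0 [l fl]] := eqVneq c 0.
  by rewrite scale0r => _; exact: ess_ideal_bounded0.
by exists (`|c| * l); apply: ess_ideal_uboundZ.
Qed.

Lemma ess_ideal_norm0 : N 0 = 0.
Proof.
apply/eqP; rewrite eq_le ess_ideal_norm_ge0 ?andbT; last first.
  exact: ess_ideal_bounded0.
apply/ler_addgt0Pl => e e0; rewrite addr0.
by apply: ess_ideal_norm_le; apply: ess_ideal_ubound0.
Qed.

Lemma ler_ess_ideal_normD f g : bounded f -> bounded g ->
  N (f + g) <= N f + N g.
Proof.
move=> Bf Bg; rewrite -lerBlDr; apply: ess_ideal_norm_ge => // l fl.
rewrite lerBlDr -lerBlDl; apply: ess_ideal_norm_ge => // m gm.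
by rewrite lerBlDl; apply: ess_ideal_norm_le; apply: ess_ideal_uboundD.
Qed.

Lemma ler_ess_ideal_normZ c f : c != 0 -> bounded f -> N (c *: f) <= `|c| * N f.
Proof.
move=> c0 Bf; have nc0 : 0 < `|c| by rewrite normr_gt0.
rewrite -ler_pdivrMl//; apply: ess_ideal_norm_ge => // l fl.
by rewrite ler_pdivrMl//; apply: ess_ideal_norm_le; apply: ess_ideal_uboundZ.
Qed.

Lemma ess_ideal_normZ c f : bounded f -> N (c *: f) = `|c| * N f.
Proof.
have [->|c0 Bf] := eqVneq c 0.
  by rewrite scale0r normr0 mul0r ess_ideal_norm0.
apply/eqP; rewrite eq_le ler_ess_ideal_normZ//=.
rewrite -ler_pdivlMl ?normr_gt0// -normfV.
rewrite -{1}[f](scalerK c0); apply: ler_ess_ideal_normZ.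
  by rewrite invr_eq0.
exact: ess_ideal_boundedZ.
Qed.

End essential_bounds.

Theorem theorem2p6 (d : measure_display) (X : measurableType d) (R : realType)
    (mu : {measure set X -> \bar R}) (I : set {mfun X >-> R})
    (hI : is_ideal I) :
  pseudonormed_subspace (ess_ideal_bounded mu I) (ess_ideal_norm mu I).
Proof.
split.
  split; first by rewrite inE; exact: ess_ideal_bounded0.
  move=> c f g; rewrite !inE => Bf Bg.
  by apply: ess_ideal_boundedD => //; apply: ess_ideal_boundedZ.
split.
- exact: ess_ideal_norm_ge0.
- exact: ess_ideal_norm0.
- exact: ler_ess_ideal_normD.
- exact: ess_ideal_normZ.
Qed.
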